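(* Let $X$ be a finite simplicial complex and $f\colon X\to\mathbb R$ a generic linear map. Let $M(X)$ be the mod $2$ incidence matrix of $X$. Let $t\in\mathbb R$ and $t_1<t_2$ be real numbers. The mod $2$ incidence matrices of the cell complexes $X_t$, $X_{t,\infty}$, $X_{-\infty,t}$, $X_{t_1,t_2}$ are obtained from the incidences of the simplices of $X$ as follows. (1) Let $\hat M(t)$ be the minor of $M(X)$ on the rows and columns of the simplices $\sigma$ with $t\in\operatorname{int}[\sigma]$, each such $\sigma$ being regarded as the cell $\hat\sigma=\sigma\cap X_t$ of dimension $\dim\sigma-1$. If no vertex of $X$ takes the value $t$, then the incidence matrix $M(X_t)$ equals $\hat M(t)$. If there is a (necessarily unique) vertex $v$ with $f(v)=t$, then $M(X_t)$ is $\hat M(t)$ enlarged by one additional row and column for $v$, viewed as a $0$-cell and placed before all other cells. In this row, the entry for the pair $(v,\hat\sigma)$ is $1$ if $\sigma$ is a $2$-simplex having $v$ as a vertex, and $0$ otherwise. The column of $v$ is zero. (2) The incidence matrices of $X_{t,\infty}$ and $X_{-\infty,t}$ are $$\begin{pmatrix} M(X_t)&B^+\\0&\hat M(t,\infty)\end{pmatrix}\quad\text{and}\quad \begin{pmatrix} M(X_t)&B^-\\0&\hat M(-\infty,t)\end{pmatrix}$$ respectively. Here $\hat M(t,\infty)$ and $\hat M(-\infty,t)$ are the minors of $M(X)$ on the simplices in $\mathcal X(t,\infty)=\{\sigma: [\sigma]\cap(t,\infty)\neq\emptyset\}$ and $\mathcal X(-\infty,t)=\{\sigma:[\sigma]\cap(-\infty,t)\ne\emptyset\}$.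 An entry of $B^+$ (resp. $B^-$), indexed by a cell $c$ of $X_t$ and a simplex $\sigma$ in $\mathcal X(t,\infty)$ (resp. $\mathcal X(-\infty,t)$), is $1$ if either $c=\hat\sigma$, or $c$ is a vertex of $X$ and $\sigma$ is a $1$-simplex incident to it; it is $0$ otherwise. (3) The incidence matrix of $X_{t_1,t_2}$ is $$\begin{pmatrix} M(X_{t_1})&0&B^+\\0&M(X_{t_2})&B^-\\0&0&\hat M(t_1,t_2)\end{pmatrix}.$$ Here $\hat M(t_1,t_2)$ is the minor of $M(X)$ on the simplices in $\mathcal X(t_1,t_2)=\{\sigma:[\sigma]\cap(t_1,t_2)\ne\emptyset\}$. The matrix $B^+$ (resp. $B^-$) is indexed by cells of $X_{t_1}$ (resp. $X_{t_2}$) and simplices of $\mathcal X(t_1,t_2)$, and is defined by the same rule as in (2), with $\hat\sigma=\sigma\cap X_{t_1}$ (resp. $\hat\sigma=\sigma\cap X_{t_2}$).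
   Context: $X$ denotes both a simplicial complex and its geometric realization. A linear map $f\colon X\to\mathbb R$ is a continuous map whose restriction to each simplex is linear (affine). It is generic if it is injective on the set of vertices. Put $X_t=f^{-1}(t)$, $X_{t,\infty}=f^{-1}([t,\infty))$, $X_{-\infty,t}=f^{-1}((-\infty,t])$, $X_{t_1,t_2}=f^{-1}([t_1,t_2])$. For a simplex $\sigma$, $[\sigma]$ is the closed interval that is the convex hull of $\{f(v): v\text{ a vertex of }\sigma\}$, and $\operatorname{int}[\sigma]$ is its interior (empty if $\sigma$ is a vertex). A geometric cell complex is a union of a collection of nondegenerate convex cells with disjoint interiors such that all faces of a cell of the collection belong to the collection. The mod $2$ incidence matrix of a finite cell complex with ordered cells $\sigma_1,\dots,\sigma_n$ has $(i,j)$ entry $1$ if $\sigma_i$ is a face of codimension $1$ of $\sigma_j$, and $0$ otherwise. Simplices of $X$ are ordered so that faces precede the simplices they bound, and minors keep the induced order. ''Minor'' means the submatrix on the indicated rows and columns. The cell structures are as follows. - The cells of $X_t$ are the sets $\hat\sigma=\sigma\cap X_t$ for simplices $\sigma$ with $t\in\operatorname{int}[\sigma]$, together with the vertex $v$ with $f(v)=t$ if there is one. - The cells of $X_{t,\infty}$ are the cells of $X_t$ together with the sets $\sigma\cap X_{t,\infty}$, for $\sigma\in\mathcal X(t,\infty)$. The cell $\sigma\cap X_{t,\infty}$ has dimension $\dim\sigma$ and is identified with $\sigma$ as a row/column index. The description of $X_{-\infty,t}$ is analogous. - The cells of $X_{t_1,t_2}$ are the cells of $X_{t_1}$, the cells of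 $X_{t_2}$, and the sets $\sigma\cap X_{t_1,t_2}$ for $\sigma\in\mathcal X(t_1,t_2)$, of dimension $\dim\sigma$ and identified with $\sigma$ as a row/column index. *)

(* Defs.v *)
From HB Require Import structures.
From mathcomp Require Import all_boot all_order all_algebra.
From mathcomp Require Import all_classical all_reals all_analysis.
Import numFieldNormedType.Exports.
Import Order.TTheory GRing.Theory Num.Theory.

Set Implicit Arguments.
Unset Strict Implicit.
Unset Printing Implicit Defensive.

Local Open Scope classical_set_scope.
Local Open Scope ring_scope.

(* Convex hull of the finite family (g v), v \in S; it is empty if S is. *)
Definition conv_hull (R : realType) (E : lmodType R) (V : finType)
    (g : V -> E) (S : {set V}) : set E :=
  [set x | exists w : V -> R,
     [/\ forall v, v \in S -> 0 <= w v,
         \sum_(v in S) w v = 1 &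
         x = \sum_(v in S) w v *: g v]].

Definition aff_indep (R : realType) (E : lmodType R) (I : finType)
    (p : I -> E) (S : {set I}) : Prop :=
  forall w : I -> R,
    \sum_(i in S) w i = 0 -> \sum_(i in S) w i *: p i = 0 ->
    forall i, i \in S -> w i = 0.

(* C has affine dimension d: it contains d + 1 affinely independent points but
   not d + 2. The empty set has no dimension. *)
Definition has_dim (R : realType) (N : nat) (C : set 'rV[R]_N) (d : nat)
    : Prop :=
  (exists p : 'I_d.+1 -> 'rV[R]_N,
     (forall i, C (p i)) /\ aff_indep p [set: 'I_d.+1]%SET) /\
  ~ (exists p : 'I_d.+2 -> 'rV[R]_N,
     (forall i, C (p i)) /\ aff_indep p [set: 'I_d.+2]%SET).

(* Faces of a convex cell are its intersections with supporting hyperplanes;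
   l = 0, b = 0 gives the cell itself. *)
Definition is_face (R : realType) (N : nat) (F C : set 'rV[R]_N) : Prop :=
  F !=set0 /\
  exists (l : {scalar 'rV[R]_N}) (b : R),
    (forall x, C x -> l x <= b) /\ F = C `&` [set x | l x = b].

Definition codim1_face (R : realType) (N : nat) (F C : set 'rV[R]_N) : Prop :=
  is_face F C /\ exists d, has_dim F d /\ has_dim C d.+1.

Definition incidence_mx (R : realType) (N n : nat)
    (c : 'I_n -> set 'rV[R]_N) : 'M['F_2]_n :=
  \matrix_(i, j) (`[< codim1_face (c i) (c j) >])%:R.

(* Concatenation of two ordered lists of cells. *)
Definition cat_cells (R : realType) (N m n : nat)
    (c : 'I_m -> set 'rV[R]_N) (d : 'I_n -> set 'rV[R]_N)
    : 'I_(m + n) -> set 'rV[R]_N :=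
  fun k => match fintype.split k with inl i => c i | inr j => d j end.

(* Submatrix on the rows and columns in A, in the induced order (enum_val is
   increasing on ordinals). *)
Definition minor_mx (n : nat) (M : 'M['F_2]_n) (A : {set 'I_n}) : 'M['F_2]_#|A| :=
  mxsub enum_val enum_val M.

(* A finite geometric simplicial complex in R^N. V is exactly the vertex set,
   and a simplex is given by its set of vertices. *)
Record simplicial_complex (R : realType) (N : nat) (V : finType) :=
  SimplicialComplex {
    pos : V -> 'rV[R]_N;
    simplices : {set {set V}};
    simplices_neq0 : finset.set0 \notin simplices;
    simplices_vertex : forall v, [set v]%SET \in simplices;
    simplices_down : forall S T : {set V},
      S \in simplices -> T \subset S -> T != finset.set0 -> T \in simplices;
    simplices_indep : forall S, S \in simplices -> aff_indep pos S;
    simplices_cap : forall S T, S \in simplices -> T \in simplices ->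
      conv_hull pos S `&` conv_hull pos T = conv_hull pos (S :&: T)%SET
  }.

Section Complex.
Context {R : realType} {N : nat} {V : finType}.
Variables (X : simplicial_complex R N V) (f : 'rV[R]_N -> R).

Definition realization : set 'rV[R]_N :=
  [set x | exists2 S, S \in simplices X & conv_hull (pos X) S x].

(* f is a total function of which only the restriction to X matters. *)
Definition linear_map : Prop :=
  {within realization, continuous f} /\
  forall S, S \in simplices X ->
    forall x y (a : R), conv_hull (pos X) S x -> conv_hull (pos X) S y ->
      0 <= a <= 1 ->
      f (a *: x + (1 - a) *: y) = a * f x + (1 - a) * f y.

Definition generic : Prop := injective (f \o pos X).

Definition X_at (t : R) := realization `&` f @^-1` [set t].
Definition X_ge (t : R) := realization `&` f @^-1` `[t, +oo[.
Definition X_le (t : R) := realization `&` f @^-1` `]-oo, t].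
Definition X_btw (t1 t2 : R) := realization `&` f @^-1` `[t1, t2].

(* The interval [sigma]. *)
Definition bracket (S : {set V}) : set R :=
  @conv_hull R R^o V (f \o pos X) S.

Definition face_ordering (n : nat) (s : 'I_n -> {set V}) : Prop :=
  [/\ injective s,
      forall S, S \in simplices X <-> exists i, s i = S &
      forall i j, s i \proper s j -> (i < j)%N].

Context {n : nat}.
Variable s : 'I_n -> {set V}.

Definition simplex_cells (i : 'I_n) : set 'rV[R]_N := conv_hull (pos X) (s i).

(* There is at most one such vertex when f is generic. *)
Definition level_vertices (t : R) : {set V} := [set v | f (pos X v) == t]%SET.

Definition crossing (t : R) : {set 'I_n} :=
  [set i | `[< interior (bracket (s i)) t >]]%SET.
Definition above (t : R) : {set 'I_n} :=
  [set i | `[< bracket (s i) `&` `]t, +oo[ !=set0 >]]%SET.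
Definition below (t : R) : {set 'I_n} :=
  [set i | `[< bracket (s i) `&` `]-oo, t[ !=set0 >]]%SET.
Definition between (t1 t2 : R) : {set 'I_n} :=
  [set i | `[< bracket (s i) `&` `]t1, t2[ !=set0 >]]%SET.

Definition slice_cells (A : {set 'I_n}) (Y : set 'rV[R]_N)
    : 'I_#|A| -> set 'rV[R]_N :=
  fun j => conv_hull (pos X) (s (enum_val j)) `&` Y.
Arguments slice_cells A Y _ : clear implicits.

Definition cells_at (t : R)
    : 'I_(#|level_vertices t| + #|crossing t|) -> set 'rV[R]_N :=
  cat_cells (fun i : 'I_#|level_vertices t| => [set pos X (enum_val i)])
            (slice_cells (crossing t) (X_at t)).
Arguments cells_at t _ : clear implicits.

Definition cells_ge (t : R) :=
  cat_cells (cells_at t) (slice_cells (above t) (X_ge t)).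

Definition cells_le (t : R) :=
  cat_cells (cells_at t) (slice_cells (below t) (X_le t)).

Definition cells_btw (t1 t2 : R) :=
  cat_cells (cat_cells (cells_at t1) (cells_at t2))
            (slice_cells (between t1 t2) (X_btw t1 t2)).

Definition vertex_row (t : R) (v : V) : 'rV['F_2]_#|crossing t| :=
  \row_j ((v \in s (enum_val j)) && (#|s (enum_val j)| == 3%N))%:R.

(* sigma `&` X_t is the cell "hat sigma" only when t lies in the interior of
   [sigma]; otherwise it may be a single vertex of sigma, for sigma of any
   dimension. *)
Definition attaching_rule (t : R) (c : set 'rV[R]_N) (i : 'I_n) : Prop :=
  (i \in crossing t /\ c = conv_hull (pos X) (s i) `&` X_at t) \/
  (exists v, [/\ c = [set pos X v], v \in s i & #|s i| = 2%N]).

Definition attaching_mx (t : R) (A : {set 'I_n})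
    : 'M['F_2]_(#|level_vertices t| + #|crossing t|, #|A|) :=
  \matrix_(k, j) (`[< attaching_rule t (cells_at t k) (enum_val j) >])%:R.

End Complex.

Arguments cells_at {R N V} X f {n} s t _.
Arguments cells_ge {R N V} X f {n} s t _.
Arguments cells_le {R N V} X f {n} s t _.
Arguments cells_btw {R N V} X f {n} s t1 t2 _.

(* Main.v *)
(** Every cell in sight has the form conv S `&` f^-1 J for a simplex S, and meets
    the relative interior of conv S. Hence a cell over S can only be a face of a
    cell over T if S is a subset of T, and the incidences are then decided by
    dimensions: the dimension is that of S when f takes an interior value of J at
    a relative interior point of S, one less for a slice f^-1 t with t inside [S],
    and 0 for a vertex. Conversely the required faces are cut out by affine
    functionals prescribed on the vertices of T: the functional that vanishes on S
    and is -1 on the other vertices, or, for the slice at an endpoint of J, the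
    affine extension of f restricted to T up to sign. *)

Require Import Defs.
From mathcomp Require Import all_boot all_order all_algebra.
From mathcomp Require Import all_classical all_reals all_analysis.
From mathcomp Require Import ring lra.
Import numFieldNormedType.Exports.
Import Order.TTheory GRing.Theory Num.Theory.

Set Implicit Arguments.
Unset Strict Implicit.
Unset Printing Implicit Defensive.

Local Open Scope classical_set_scope.
Local Open Scope ring_scope.

(** * Affine independence of families *)

Section AffineIndependence.
Context {R : realType} {E : lmodType R}.

Lemma aff_indep_comp (I J : finType) (p : J -> E) (S : {set J}) (h : I -> J) :
  injective h -> (forall i, h i \in S) -> aff_indep p S ->
  aff_indep (p \o h) [set: I]%SET.
Proof.
move=> h_inj hS pS w w1 wp i _.
(* The coefficients are pushed forward along [h]: [w'] carries [w] on the image and is 0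
   elsewhere. *)
pose w' j := \sum_(k | h k == j) w k.
have w'h k : w' (h k) = w k.
  rewrite /w' (bigD1 k) //= big1 ?addr0 // => k' /andP[/eqP/h_inj-> /eqP//].
rewrite -w'h; apply: (pS w') => //.
  rewrite -[RHS]w1 [RHS](partition_big h (mem S)) //=.
  by apply: eq_bigr => j _; apply: eq_bigl => k; rewrite inE.
rewrite -[RHS]wp [RHS](partition_big h (mem S)) //=.
apply: eq_bigr => j _; rewrite scaler_suml.
by apply: eq_big => [k|k /eqP <-//]; rewrite inE.
Qed.

Lemma aff_indep_all0 (J : finType) (p : J -> E) (S : {set J}) (w : J -> R) :
  aff_indep p S -> (forall v, v \notin S -> w v = 0) ->
  \sum_v w v = 0 -> \sum_v w v *: p v = 0 -> forall v, w v = 0.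
Proof.
move=> pS w0 w1 wp v; have [vS|/w0//] := boolP (v \in S).
apply: (pS w) => //.
  rewrite -[RHS]w1 big_mkcond; apply: eq_bigr => j _.
  by case: ifPn => // /w0.
rewrite -[RHS]wp big_mkcond; apply: eq_bigr => j _.
by case: ifPn => // /w0->; rewrite scale0r.
Qed.

End AffineIndependence.

(** * Barycentric weights and their perturbation *)

Section Weights.
Context {R : realType} {E : lmodType R} {V : finType}.
Implicit Types (p : V -> E) (S T : {set V}) (w : V -> R).

(** Unlike in [conv_hull], the weights must vanish off [S], so that weights of different faces can
    be compared and mixed as functions on [V]. *)
Definition weights S w : Prop :=
  [/\ forall v, 0 <= w v, forall v, v \notin S -> w v = 0 & \sum_v w v = 1].

Definition bary p w : E := \sum_v w v *: p v.

Lemma conv_hullE p S : conv_hull p S = [set bary p w | w in weights S].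
Proof.
apply/seteqP; split=> x /=.
  move=> [w [w0 w1 ->]].
  exists (fun v => if v \in S then w v else 0); first split.
  - by move=> v; case: ifPn => // /w0.
  - by move=> v /negbTE->.
  - by rewrite -w1 [RHS]big_mkcond.
  rewrite /bary [RHS]big_mkcond; apply: eq_bigr => v _.
  by case: ifP; rewrite ?scale0r.
move=> [w [w0 wS w1] <-]; exists w; split=> //.
  rewrite -w1 big_mkcond; apply: eq_bigr => j _.
  by case: ifPn => // /wS.
rewrite /bary [RHS]big_mkcond; apply: eq_bigr => j _.
by case: ifPn => // /wS->; rewrite scale0r.
Qed.

Lemma baryD p w1 w2 (a b : R) :
  bary p (fun v => a * w1 v + b * w2 v) = a *: bary p w1 + b *: bary p w2.
Proof.
rewrite /bary !scaler_sumr -big_split /=; apply: eq_bigr => v _.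
by rewrite scalerDl !scalerA.
Qed.

Lemma weights_mix S w1 w2 (a : R) : 0 <= a <= 1 ->
  weights S w1 -> weights S w2 -> weights S (fun v => (1 - a) * w1 v + a * w2 v).
Proof.
move=> /andP[a0 a1] [p1 z1 s1] [p2 z2 s2]; split.
- by move=> v; rewrite addr_ge0 // mulr_ge0 // subr_ge0.
- by move=> v vS; rewrite z1 // z2 // !mulr0 addr0.
- by rewrite big_split /= -!mulr_sumr s1 s2; ring.
Qed.

Lemma weights_subset S T w : S \subset T -> weights S w -> weights T w.
Proof.
move=> ST [p z s]; split=> // v vT; apply: z.
by apply: contra vT; apply: fintype.subsetP.
Qed.

Definition vertex_weight (v u : V) : R := (u == v)%:R.

Lemma vertex_weightP S v : v \in S -> weights S (vertex_weight v).
Proof.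
move=> vS; split.
- by move=> u; rewrite /vertex_weight ler0n.
- by move=> u; rewrite /vertex_weight; case: eqP => // ->; rewrite vS.
- rewrite (bigD1 v) //= /vertex_weight eqxx big1 ?addr0 // => u.
  by move=> /negbTE->.
Qed.

Lemma bary_vertex p v : bary p (vertex_weight v) = p v.
Proof.
rewrite /bary (bigD1 v) //= /vertex_weight eqxx scale1r big1 ?addr0 // => u.
by move=> /negbTE->; rewrite scale0r.
Qed.

Definition uniform_weight S (v : V) : R := (v \in S)%:R / #|S|%:R.

Lemma uniform_weightP S : S != finset.set0 ->
  weights S (uniform_weight S) /\ forall v, v \in S -> 0 < uniform_weight S v.
Proof.
rewrite -card_gt0 => S0.
have S0' : 0 < #|S|%:R :> R by rewrite ltr0n.
rewrite /uniform_weight; split; last first.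
  by move=> v ->; rewrite mul1r invr_gt0.
split.
- by move=> v; rewrite divr_ge0 // ler0n.
- by move=> v /negbTE->; rewrite mul0r.
- rewrite -mulr_suml -natr_sum -[in X in _ / X]sum1_card [in X in _ / X]big_mkcond /=.
  rewrite [X in _ / X%:R](_ : _ = \sum_i (i \in S))%N; last first.
    by apply: eq_bigr => i _; case: (_ \in _).
  rewrite divff // pnatr_eq0 -lt0n; move: S0; rewrite -sum1_card big_mkcond /=.
  by congr (_ < _)%N; apply: eq_bigr => i _; case: (_ \in _).
Qed.

Lemma bary_inj p S w1 w2 : aff_indep p S -> weights S w1 -> weights S w2 ->
  bary p w1 = bary p w2 -> forall v, w1 v = w2 v.
Proof.
move=> pS [_ z1 s1] [_ z2 s2] e v.
suff /(_ v) : forall v, w1 v - w2 v = 0 by move/eqP; rewrite subr_eq0 => /eqP.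
apply: (aff_indep_all0 pS).
- by move=> u uS; rewrite z1 // z2 // subr0.
- by rewrite sumrB s1 s2 subrr.
- under eq_bigr do rewrite scalerBl.
  by rewrite sumrB; apply/eqP; rewrite subr_eq0; apply/eqP.
Qed.

Lemma weights_ex_vertex S w (P : pred V) :
  weights S w -> (forall v, v \in S -> ~~ P v -> w v = 0) ->
  exists2 v, v \in S & P v.
Proof.
move=> [_ z s] h; apply/exists_inP; apply: contraT => /exists_inPn H; exfalso.
move: s; rewrite big1 => [/esym/eqP|v _]; first by rewrite oner_eq0.
by have [vS|/z//] := boolP (v \in S); apply: h => //; apply: H.
Qed.

(* Perturbing w0 in the directions d keeps nonnegativity since w0 > 0 on S. *)
Lemma weights_perturb S (I : finType) (T : {set I}) w0 (d : I -> V -> R)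
    (x : I -> R) (eps : R) :
  weights S w0 -> (forall v, v \in S -> 0 < w0 v) -> 0 < eps ->
  (forall i, i \in T -> forall v, v \notin S -> d i v = 0) ->
  (forall i, i \in T -> \sum_v d i v = 0) ->
  exists2 e : R, 0 < e & forall i, i \in T ->
    weights S (fun v => w0 v + e * d i v) /\ `|e * x i| < eps.
Proof.
move=> [p0 z0 s0] w0_gt0 eps_gt0 dS d0.
(* [m] is the least of [eps] and the weights on [S], and [M] bounds all coordinates of [x] and of
   the directions; the factor [m / (1 + M)] makes every change smaller than [m]. *)
pose m := \big[Num.min/eps]_(v in S) w0 v.
pose M := \sum_i (`|x i| + \sum_v `|d i v|).
have M0 : 0 <= M by apply: sumr_ge0 => i _; rewrite addr_ge0 // sumr_ge0.
have m0 : 0 < m by apply: lt_bigmin.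
have e_gt0 : 0 < m / (1 + M) by rewrite divr_gt0 // ltr_pwDl.
have small (y : R) : `|y| <= M -> `|m / (1 + M) * y| < m.
  move=> yM; rewrite normrM (gtr0_norm e_gt0) mulrAC ltr_pdivrMr ?ltr_pwDl //.
  by rewrite ltr_pM2l //; lra.
have le_M i : `|x i| + \sum_v `|d i v| <= M.
  rewrite /M (bigD1 i) //= lerDl.
  by apply: sumr_ge0 => j _; rewrite addr_ge0 // sumr_ge0.
exists (m / (1 + M)) => // i iT; split; last first.
  apply: (@lt_le_trans _ _ m); last by apply: bigmin_le_id.
  apply: small; apply: le_trans (le_M i).
  by rewrite lerDl sumr_ge0.
split.
- move=> v; have [vS|vS] := boolP (v \in S); last by rewrite z0 // dS // mulr0 addr0.
  have mw : m <= w0 v by apply: bigmin_le_cond.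
  have : `|m / (1 + M) * d i v| < m.
    apply: small; apply: le_trans (le_M i).
    rewrite (bigD1 v) //= addrCA lerDl addr_ge0 // sumr_ge0 //.
  rewrite ltr_norml => /andP[+ _]; lra.
- by move=> v vS; rewrite z0 // dS // mulr0 addr0.
- by rewrite big_split /= -mulr_sumr d0 // s0 mulr0 addr0.
Qed.

(** In an affine relation of the perturbed points the coefficients sum to 0, so [w0] cancels;
    independence of [p] on [S] then forces the same combination of the directions to vanish. *)
Lemma aff_indep_perturb p S (I : finType) (T : {set I}) w0 (d : I -> V -> R)
    (e : R) :
  aff_indep p S -> e != 0 ->
  (forall i, i \in T -> forall v, v \notin S -> d i v = 0) ->
  (forall i, i \in T -> \sum_v d i v = 0) ->
  (forall a : I -> R, \sum_(i in T) a i = 0 ->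
    (forall v, \sum_(i in T) a i * d i v = 0) -> forall i, i \in T -> a i = 0) ->
  aff_indep (fun i => bary p (fun v => w0 v + e * d i v)) T.
Proof.
move=> pS e0 dS d0 indep a a1 ap; apply: indep => //.
apply: (aff_indep_all0 pS).
- by move=> v vS; apply: big1 => i iT; rewrite dS // mulr0.
- rewrite exchange_big /=; apply: big1 => i iT.
  by rewrite -mulr_sumr d0 // mulr0.
- have dir i : e *: \sum_v (a i * d i v) *: p v =
      a i *: bary p (fun v => w0 v + e * d i v) - a i *: bary p w0.
    rewrite -scalerBr /bary -sumrB !scaler_sumr; apply: eq_bigr => v _.
    by rewrite -scalerBl addrC addKr !scalerA; congr (_ *: _); ring.
  have : e *: \sum_v (\sum_(i in T) a i * d i v) *: p v = 0.
    under eq_bigr do rewrite scaler_suml.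
    rewrite exchange_big /= scaler_sumr (eq_bigr _ (fun i _ => dir i)).
    by rewrite sumrB ap -scaler_suml a1 scale0r subr0.
  by move/eqP; rewrite scaler_eq0 (negbTE e0) => /eqP.
Qed.

End Weights.

(** * Affine functionals and affine dimension *)

Section Dimension.
Context {R : realType} {N : nat}.
Implicit Types (C : set 'rV[R]_N).

(** Affine independence means that the rows (1, p i) are linearly independent; the matrix [A] of
    these rows then has a right inverse, so any values [h] can be interpolated. *)
Lemma aff_functional k (p : 'I_k -> 'rV[R]_N) (h : 'I_k -> R) :
  aff_indep p [set: 'I_k]%SET ->
  exists (l : {scalar 'rV[R]_N}) (c : R), forall i, l (p i) = h i + c.
Proof.
move=> pk.
pose A : 'M[R]_(k, 1 + N) := \matrix_i row_mx (1 : 'rV_1) (p i).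
have uA (u : 'rV_k) : u *m A = row_mx ((\sum_i u 0 i)%:M) (\sum_i u 0 i *: p i).
  rewrite mulmx_sum_row; under eq_bigr do rewrite rowK scale_row_mx.
  have -> F G : \sum_i row_mx (F i) (G i) = row_mx (\sum_(i < k) F i) (\sum_i G i)
      :> 'rV[R]_(1 + N).
    apply/rowP => j; rewrite summxE !mxE; case: split_ordP => j' ->;
      rewrite summxE; apply: eq_bigr => i _; by rewrite ?row_mxEl ?row_mxEr.
  congr row_mx; apply/matrixP => i j.
  by rewrite summxE !mxE !ord1 eqxx; apply: eq_bigr => m _; rewrite !mxE mulr1.
have /row_freeP[B AB] : row_free A.
  apply: inj_row_free => u; rewrite uA => /eqP.
  rewrite row_mx_eq0 => /andP[/eqP u1 /eqP up].
  apply/rowP => i; rewrite mxE; apply: (pk (fun i => u 0 i)) => //.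
  - have /matrixP/(_ 0 0) := u1; rewrite !mxE eqxx mulr1n => e; rewrite -[RHS]e.
    by apply: eq_bigl => j; rewrite inE.
  - by rewrite -[RHS]up; apply: eq_bigl => j; rewrite inE.
pose Q := B *m (\col_i h i).
have AQ : A *m Q = \col_i h i by rewrite /Q mulmxA AB mul1mx.
(* The trace reads a 1 x 1 matrix as a scalar. The top entry of [Q], which multiplies the leading 1
   of each row, becomes the constant with opposite sign. *)
pose l : {scalar 'rV[R]_N} := mxtrace \o mulmxr (dsubmx Q).
exists l, (- (usubmx Q 0 0)) => i.
have /rowP/(_ 0) : row i (A *m Q) = row i (\col_i h i) by rewrite AQ.
rewrite row_mul rowK -[in LHS](vsubmxK Q) mul_row_col mul1mx !mxE /= => <-.
by rewrite trace_mx11 !mxE addrAC subrr add0r.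
Qed.

Lemma has_dimI C d (I : finType) (T : {set I}) (q : I -> 'rV[R]_N) :
  #|T| = d.+1 -> aff_indep q T -> (forall i, i \in T -> C (q i)) ->
  (forall k (p : 'I_k -> 'rV[R]_N), (forall i, C (p i)) ->
     aff_indep p [set: 'I_k]%SET -> (k <= d.+1)%N) ->
  has_dim C d.
Proof.
move=> Td qT qC up; split; last first.
  by move=> [p [pC pI]]; have := up _ _ pC pI; rewrite ltnn.
exists (q \o (fun i : 'I_d.+1 => enum_val (cast_ord (esym Td) i))); split.
  by move=> i; apply/qC/enum_valP.
apply: aff_indep_comp qT => [i j /enum_val_inj/cast_ord_inj//|i].
exact: enum_valP.
Qed.

Lemma has_dim_uniq C d e : has_dim C d -> has_dim C e -> d = e.
Proof.
wlog de : d e / (d < e)%N => [H Cd Ce|[_ Cd] [[p [pC pI]] _]].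
  by have [/H|/H|//] := ltngtP d e => H'; [|apply/esym]; apply: H'.
have le : (d.+2 <= e.+1)%N by [].
exfalso; apply: Cd; exists (p \o widen_ord le); split=> [i|]; first exact: pC.
apply: aff_indep_comp pI => [i j /(congr1 val) /= ij|i]; first exact: val_inj.
by rewrite inE.
Qed.

End Dimension.

(** * Cells cut out of a simplex by values of f *)

Section Cells.
Context {R : realType} {N : nat} {V : finType}.
Context (X : simplicial_complex R N V) (f : 'rV[R]_N -> R).
Context (f_linear : linear_map X f).
Implicit Types (S T : {set V}) (w : V -> R) (J : set R) (C D : set 'rV[R]_N).

Local Notation pos := (pos X).

(** The value of [f] at [bary pos w] for weights on a simplex, by [f_bary]. *)
Definition level w : R := \sum_v w v * f (pos v).

Lemma simplex_neq0 S : S \in simplices X -> S != finset.set0.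
Proof. by apply: contraTneq => ->; apply: simplices_neq0. Qed.

Lemma conv_bary S w : weights S w -> conv_hull pos S (bary pos w).
Proof. by move=> wS; rewrite conv_hullE; exists w. Qed.

Lemma level_vertex v : level (vertex_weight v) = f (pos v).
Proof. exact: (@bary_vertex R R^o V (f \o pos) v). Qed.

Lemma levelD w1 w2 (a b : R) :
  level (fun v => a * w1 v + b * w2 v) = a * level w1 + b * level w2.
Proof. exact: (@baryD R R^o V (f \o pos)). Qed.

(** Induction on the size of a subset [S'] of the fixed simplex [S] that supports [w]: one vertex of
    nonzero weight is split off, and [f] is affine on the segment from it to the point given by the
    remaining weights. *)
Lemma f_bary S w : S \in simplices X -> weights S w -> f (bary pos w) = level w.
Proof.
move=> SX wS.
have [k] := ubnP #|S|.
suff H S' : S' \subset S -> (#|S'| < k)%N -> weights S' w -> f (bary pos w) = level w.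
  by move=> /H; apply.
elim: k S' w {wS} => // k IH S' w S'S; rewrite ltnS => S'k wS'.
have [_ z s] := wS'; have [p _ _] := wS'.
have [v vS' wv0] : exists2 v, v \in S' & w v != 0.
  by apply: (weights_ex_vertex wS') => v _ /negPn/eqP.
have s' : \sum_(u | u != v) w u = 1 - w v.
  by rewrite -s [in RHS](bigD1 v) //= addrAC subrr add0r.
have wv1 : 0 <= w v <= 1.
  by rewrite p /= -subr_ge0 -s' sumr_ge0.
(* When all the weight sits at [v], the rest cannot be renormalized and the point is the vertex
   itself. *)
have [wv|wv] := eqVneq (w v) 1.
  suff -> : w = vertex_weight v.
    by rewrite bary_vertex level_vertex.
  apply/funext => u; rewrite /vertex_weight; case: eqVneq => [->//|uv].
  by move: s'; rewrite wv subrr => /psumr_eq0P ->.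
have nz : 1 - w v != 0 by rewrite subr_eq0 eq_sym.
pose w' u := if u == v then 0 else w u / (1 - w v).
have w'S' : weights (S' :\ v)%SET w'.
  split.
  - move=> u; rewrite /w'; case: ifP => // _; rewrite divr_ge0 //.
    by case/andP: wv1; rewrite subr_ge0.
  - move=> u; rewrite !inE /w'; case: eqP => //= _ /z->.
    by rewrite mul0r.
  - rewrite (bigD1 v) //= /w' eqxx add0r.
    transitivity ((\sum_(u | u != v) w u) / (1 - w v)); last by rewrite s' divff.
    by rewrite mulr_suml; apply: eq_bigr => u /negbTE->.
have -> : w = (fun u => w v * vertex_weight v u + (1 - w v) * w' u).
  apply/funext => u; rewrite /vertex_weight /w'; case: eqVneq => [->|uv].
    by rewrite mulr1 mulr0 addr0.
  by rewrite mulr0 add0r mulrCA divff // mulr1.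
have vS : v \in S := fintype.subsetP S'S _ vS'.
have S'vS : (S' :\ v)%SET \subset S := fintype.subset_trans (subD1set _ _) S'S.
rewrite levelD level_vertex baryD bary_vertex -(IH (S' :\ v)%SET) //.
  have [_ fS] := f_linear; rewrite (fS S) //.
    rewrite -(bary_vertex pos v); exact/conv_bary/vertex_weightP.
  exact/conv_bary/(weights_subset S'vS).
by apply: leq_trans S'k; rewrite [X in (_ < X)%N](cardsD1 v) vS'.
Qed.

(** The vertices of a simplex are affinely independent, so vertex values can be prescribed up to a
    common constant; this is the source of all supporting hyperplanes below. *)
Lemma simplex_functional S (h : V -> R) : S \in simplices X ->
  exists (l : {scalar 'rV[R]_N}) (c : R), forall w, weights S w ->
    l (bary pos w) = \sum_v w v * h v + c.
Proof.
move=> SX; have pS := @simplices_indep _ _ _ X _ SX.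
have [|l [c lc]] := @aff_functional _ _ #|S| (pos \o enum_val) (h \o enum_val).
  by apply: aff_indep_comp pS => [|i]; [apply: enum_val_inj|apply: enum_valP].
exists l, c => w [_ z s].
rewrite /bary linear_sum -[X in _ + X]mul1r -s mulr_suml -big_split /=.
apply: eq_bigr => v _; rewrite linearZ /= -mulrDr.
have [vS|/z->] := boolP (v \in S); last by rewrite !mul0r.
by have := lc (enum_rank_in vS v); rewrite /= enum_rankK_in // => ->.
Qed.

(** The intersections are nested so that the cells of [slice_cells] have this form by conversion. *)
Definition cell S J : set 'rV[R]_N := conv_hull pos S `&` (realization X `&` f @^-1` J).

Lemma cellP S J x : S \in simplices X ->
  cell S J x <-> exists w, [/\ weights S w, J (level w) & x = bary pos w].
Proof.
move=> SX; split.
  rewrite /cell conv_hullE => -[[w wS <-] [_ /=]].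
  by rewrite (f_bary SX wS) => Jw; exists w.
move=> [w [wS Jw ->]]; split; first exact: conv_bary.
split; last by rewrite /= (f_bary SX wS).
by exists S => //; apply: conv_bary.
Qed.

Lemma cell_sub S J : cell S J `<=` conv_hull pos S.
Proof. by move=> x []. Qed.

Lemma cell_vertex v J : J (f (pos v)) -> cell [set v]%SET J = [set pos v].
Proof.
move=> Jv; have vX := simplices_vertex X v.
apply/seteqP; split=> x /=.
  move=> [+ _]; rewrite conv_hullE => -[w [p z s] <-].
  have z' u : u != v -> w u = 0 by move=> uv; apply: z; rewrite inE.
  rewrite /bary (bigD1 v) //= big1 ?addr0.
    by move: s; rewrite (bigD1 v) //= big1 ?addr0 // => ->; rewrite scale1r.
  by move=> u /z'->; rewrite scale0r.
move=> ->; apply/(cellP _ _ vX); exists (vertex_weight v); split.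
- by apply: vertex_weightP; rewrite inE.
- by rewrite level_vertex.
- by rewrite bary_vertex.
Qed.

(** The point lies in the hull of the common face of [S] and [T]; by uniqueness of barycentric
    coordinates in [S], the positive weights must sit on that face. *)
Lemma simplex_subset S T w : S \in simplices X -> T \in simplices X ->
  weights S w -> (forall v, v \in S -> 0 < w v) ->
  conv_hull pos T (bary pos w) -> S \subset T.
Proof.
move=> SX TX wS w0 wT.
have : conv_hull pos (S :&: T)%SET (bary pos w).
  by rewrite -simplices_cap //; split=> //; apply: conv_bary.
rewrite conv_hullE => -[w' w'ST e].
apply/fintype.subsetP => v vS.
have := bary_inj (simplices_indep SX) (weights_subset (subsetIl _ _) w'ST) wS e v.
have [_ z _] := w'ST; apply: contra_eqT => vT.
by rewrite z ?inE ?(negbTE vT) ?andbF // lt_eqF // w0.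
Qed.

(** * Dimensions of cells *)

Definition inner_point S w := weights S w /\ forall v, v \in S -> 0 < w v.

(** This guarantees that the cell of [S] over [J] has the full dimension of [S], see [fat_dim]. *)
Definition fat J S := exists2 w, inner_point S w &
  exists2 e : R, 0 < e & forall y, `|y - level w| < e -> J y.

Lemma conv_upper S k (p : 'I_k -> 'rV[R]_N) :
  (forall i, conv_hull pos S (p i)) -> aff_indep p [set: 'I_k]%SET ->
  (k <= #|S|)%N.
Proof.
move=> pS pI.
have {pS} /choice[w wP] : forall i, exists w, weights S w /\ p i = bary pos w.
  by move=> i; have := pS i; rewrite conv_hullE => -[w wS <-]; exists w.
pose A : 'M[R]_(k, #|S|) := \matrix_(i, j) w i (enum_val j).
suff /eqP <- : row_free A by apply: rank_leq_col.
apply: inj_row_free => u uA.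
have uw v : \sum_i u 0 i * w i v = 0.
  have [vS|vS] := boolP (v \in S); last first.
    by apply: big1 => i _; have [[_ -> //]] := wP i; rewrite mulr0.
  have /rowP/(_ (enum_rank_in vS v)) := uA; rewrite !mxE => e; rewrite -[RHS]e.
  by apply: eq_bigr => i _; rewrite mxE enum_rankK_in.
apply/rowP => i; rewrite mxE; apply: (pI (fun i => u 0 i)) => //.
  rewrite (eq_bigl xpredT) => [|j]; last by rewrite inE.
  transitivity (\sum_i \sum_v u 0 i * w i v).
    by apply: eq_bigr => j _; have [[_ _ s] _] := wP j; rewrite -mulr_sumr s mulr1.
  by rewrite exchange_big big1.
rewrite (eq_bigl xpredT) => [|j]; last by rewrite inE.
transitivity (\sum_i \sum_v (u 0 i * w i v) *: pos v).
  apply: eq_bigr => j _; have [_ ->] := wP j.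
  by rewrite /bary scaler_sumr; apply: eq_bigr => v _; rewrite scalerA.
rewrite exchange_big big1 //= => v _.
by rewrite -scaler_suml uw scale0r.
Qed.

(* A vertex off the level t can be added to any affinely independent family
   of points at level t. *)
Lemma slice_upper S (t : R) (b : V) k (p : 'I_k -> 'rV[R]_N) :
  S \in simplices X -> b \in S -> f (pos b) != t ->
  (forall i, cell S [set t] (p i)) -> aff_indep p [set: 'I_k]%SET ->
  (k < #|S|)%N.
Proof.
move=> SX bS bt pS pI.
pose q i := oapp p (pos b) (unlift (@ord0 k) i).
have q0 : q ord0 = pos b by rewrite /q unlift_none.
have qS i : q (lift ord0 i) = p i by rewrite /q liftK.
have [l [c lc]] := simplex_functional (f \o pos) SX.
have lp i : l (p i) = t + c.
  by have /(cellP _ _ SX)[w [wS /= <- ->]] := pS i; rewrite lc.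
have lb : l (pos b) = f (pos b) + c.
  rewrite -[in LHS](bary_vertex pos b) lc; last exact: vertex_weightP.
  by rewrite -level_vertex.
apply: (@conv_upper S k.+1 q).
  move=> i; case: (unliftP ord0 i) => [j ->|->].
    by rewrite qS; apply: cell_sub (pS j).
  by rewrite q0 -(bary_vertex pos b); apply/conv_bary/vertex_weightP.
move=> a a1 aq i _.
have {}a1 : a ord0 + \sum_i a (lift ord0 i) = 0.
  by rewrite -[RHS]a1 [RHS](eq_bigl xpredT) ?big_ord_recl // => j; rewrite inE.
have {}aq : a ord0 *: pos b + \sum_i a (lift ord0 i) *: p i = 0.
  rewrite -[RHS]aq [RHS](eq_bigl xpredT) => [|j]; last by rewrite inE.
  by rewrite [RHS]big_ord_recl q0; congr (_ + _); apply: eq_bigr => j _; rewrite qS.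
(* On [S] the functional [l] is [f] up to the constant [c]; applied to the relation it leaves
   [a ord0] times the nonzero difference of [f (pos b)] and [t]. *)
have a0 : a ord0 = 0.
  have := congr1 l aq; rewrite linearD linearZ linear_sum linear0 lb /=.
  under eq_bigr do rewrite linearZ /= lp.
  rewrite -mulr_suml; have -> : \sum_i a (lift ord0 i) = - a ord0.
    by apply/eqP; rewrite -addr_eq0 addrC a1.
  rewrite mulNr -mulrBr opprD addrACA subrr addr0 => /eqP.
  by rewrite mulf_eq0 subr_eq0 (negbTE bt) orbF => /eqP.
case: (unliftP ord0 i) => [j ->|-> //].
move: a1 aq; rewrite a0 scale0r !add0r => a1 aq.
by apply: (pI (a \o lift ord0)); rewrite ?inE // (eq_bigl xpredT) // => ?; rewrite inE.
Qed.

(** From the inner point [w] one moves slightly towards each vertex of [S]. The resulting points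
    stay in the cell because the changes of level are below [eps]. *)
Lemma fat_dim S J d : S \in simplices X -> fat J S -> #|S| = d.+1 ->
  has_dim (cell S J) d.
Proof.
move=> SX [w [wS w0] [eps eps0 epsJ]] Sd; have [_ z s] := wS.
pose dir v u : R := (u == v)%:R - w u.
have dS v : v \in S -> forall u, u \notin S -> dir v u = 0.
  move=> vS u uS; rewrite /dir z // subr0; case: eqP => // uv.
  by rewrite uv vS in uS.
have d0 v : v \in S -> \sum_u dir v u = 0.
  move=> vS; rewrite /dir sumrB s (bigD1 v) //= eqxx big1 ?addr0 ?subrr //.
  by move=> u /negbTE->.
have [e e0 H] := weights_perturb (fun v => level (dir v)) wS w0 eps0 dS d0.
apply: (has_dimI Sd).
- apply: (aff_indep_perturb (w0 := w) (simplices_indep SX) (lt0r_neq0 e0) dS d0).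
  move=> a a1 + u uS => /(_ u); rewrite /dir.
  under eq_bigr do rewrite mulrBr.
  rewrite sumrB -mulr_suml a1 mul0r subr0 (bigD1 u) //= eqxx mulr1 big1 ?addr0 //.
  by move=> v /andP[_]; rewrite eq_sym => /negbTE->; rewrite mulr0.
- move=> v /H[wv small]; apply/(cellP _ _ SX).
  exists (fun u => w u + e * dir v u); split=> //; apply: epsJ.
  have := levelD w (dir v) 1 e; under [X in level X]eq_fun do rewrite mul1r.
  by move=> ->; rewrite mul1r addrC addKr.
- move=> k p pC pI; rewrite -Sd; apply: conv_upper pI => i.
  exact: cell_sub (pC i).
Qed.

(* The directions e_v + c_v e_b - (1 + c_v) e_a, for v != b, preserve the level. *)
Lemma slice_dim S (t : R) d w a b : S \in simplices X ->
  inner_point S w -> level w = t -> a \in S -> b \in S ->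
  f (pos a) != f (pos b) -> #|S| = d.+2 ->
  has_dim (cell S [set t]) d.
Proof.
move=> SX [wS w0] wt aS bS ab Sd; have [_ z s] := wS.
have ab' : a != b by apply: contraNneq ab => ->.
(* This value solves f(v) + c f(b) - (1 + c) f(a) = 0. It is 0 for [v = a], where the direction
   vanishes, so [w] itself is one of the [d.+1] points. *)
pose c v := (f (pos v) - f (pos a)) / (f (pos a) - f (pos b)).
pose dir v u : R := 1 * vertex_weight v u +
  1 * (c v * vertex_weight b u + (- (1 + c v)) * vertex_weight a u).
have Tv v : v \in (S :\ b)%SET -> v \in S by rewrite inE => /andP[].
have vw1 (v : V) : \sum_u vertex_weight v u = 1 :> R.
  by have [] := @vertex_weightP R V [set v]%SET v; rewrite ?inE.
have vw0 (v u : V) : u != v -> vertex_weight v u = 0 :> R.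
  by rewrite /vertex_weight => /negbTE->.
have dS v : v \in (S :\ b)%SET -> forall u, u \notin S -> dir v u = 0.
  move=> /Tv vS u uS; have ne x : x \in S -> u != x.
    by move=> xS; apply: contraNneq uS => ->.
  by rewrite /dir !vw0 ?(mulr0, addr0) //; apply: ne.
have d0 v : v \in (S :\ b)%SET -> \sum_u dir v u = 0.
  by move=> _; rewrite /dir big_split -!mulr_sumr big_split -!mulr_sumr !vw1 /=; ring.
have dl v : level (dir v) = 0.
  rewrite /dir !levelD !level_vertex /c; field.
  by rewrite subr_eq0.
have [e e0 H] := weights_perturb (fun=> 0) wS w0 ltr01 dS d0.
have Td : #|(S :\ b)%SET| = d.+1.
  by move: Sd; rewrite (cardsD1 b) bS add1n => -[].
apply: (has_dimI Td).
- apply: (aff_indep_perturb (w0 := w) (simplices_indep SX) (lt0r_neq0 e0) dS d0).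
  move=> x x1 xd.
  (* For [u] other than [a] and [b], only the direction of [u] has a nonzero coordinate at [u]. The
     remaining coefficient [x a] vanishes because the sum is 0. *)
  have xa u : u \in (S :\ b)%SET -> u != a -> x u = 0.
    move=> uT ua; have := xd u; rewrite (bigD1 u) //= big1 ?addr0.
      move: uT; rewrite !inE => /andP[ub _].
      by rewrite /dir (@vw0 b) // (@vw0 a) // /vertex_weight eqxx /= !(mulr0, addr0, mulr1).
    move=> v /andP[_ vu]; move: uT; rewrite !inE => /andP[ub _].
    by rewrite eq_sym in vu; rewrite /dir !vw0 // !(mulr0, addr0).
  move=> u uT; have [->|ua] := eqVneq u a; last exact: xa.
  have aT : a \in (S :\ b)%SET by rewrite !inE ab'.
  move: x1; rewrite (bigD1 a) //= big1 ?addr0 // => v /andP[].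
  exact: xa.
- move=> v vT; have [wv _] := H v vT; apply/(cellP _ _ SX).
  exists (fun u => w u + e * dir v u); split=> //=.
  have := levelD w (dir v) 1 e; under [X in level X]eq_fun do rewrite mul1r.
  by move=> ->; rewrite mul1r dl mulr0 addr0.
(* The values at [a] and [b] differ, so one of these vertices is off the level [t], as [slice_upper]
   requires. *)
- have [b' b'S b't] : exists2 b', b' \in S & f (pos b') != t.
    have [at0|] := eqVneq (f (pos a)) t; last by exists a.
    by exists b => //; rewrite -at0 eq_sym.
  move=> k p pC pI; have := slice_upper SX b'S b't pC pI.
  by rewrite Sd.
Qed.

(** * Faces of cells *)

Lemma cell_face S T J : S \in simplices X -> T \in simplices X ->
  S \subset T -> cell S J !=set0 -> is_face (cell S J) (cell T J).
Proof.
move=> SX TX ST SJ; split=> //.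
(* At weights [w] this functional is [c] minus the total weight off [S]; it attains its bound [c]
   only on weights supported by [S]. *)
have [l [c lc]] := simplex_functional (fun v => - (v \notin S)%:R) TX.
exists l, c; split.
  move=> _ /(cellP _ _ TX)[w [wT _ ->]]; rewrite lc // gerDr sumr_le0 // => v _.
  by have [p _ _] := wT; rewrite mulrN oppr_le0 mulr_ge0.
apply/seteqP; split=> x.
  move=> /(cellP _ _ SX)[w [wS Jw ->]]; have wT := weights_subset ST wS.
  split; first by apply/(cellP _ _ TX); exists w.
  rewrite /= lc // big1 ?add0r // => v _.
  have [_ z _] := wS; have [vS|/z->] := boolP (v \in S); last by rewrite mul0r.
  by rewrite oppr0 mulr0.
move=> [/(cellP _ _ TX)[w [wT Jw ->]] /=]; rewrite lc // => /eqP.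
rewrite -subr_eq0 addrK => /eqP e; apply/(cellP _ _ SX); exists w; split=> //.
have [p _ s] := wT; split=> // v vS.
have := e; under eq_bigr do rewrite mulrN.
rewrite sumrN => /eqP; rewrite oppr_eq0 => /eqP/psumr_eq0P wz.
have : w v * (v \notin S)%:R = 0 by apply: wz => // u _; rewrite mulr_ge0.
by rewrite vS mulr1.
Qed.

Definition endpoint J (t : R) :=
  J t /\ ((forall y, J y -> t <= y) \/ (forall y, J y -> y <= t)).

Lemma slice_face T J (t : R) : T \in simplices X -> endpoint J t ->
  cell T [set t] !=set0 -> is_face (cell T [set t]) (cell T J).
Proof.
move=> TX [Jt Je] ne; split=> //.
(* The sign [e] makes [t] a maximum on [J], whichever end of [J] it is. *)
have [e e0 eJ] : exists2 e : R, e != 0 & forall y, J y -> e * y <= e * t.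
  case: Je => h; [exists (-1)|exists 1]; rewrite ?oppr_eq0 ?oner_eq0 // => y /h.
    by rewrite !mulN1r lerN2.
  by rewrite !mul1r.
have [l [c lc']] := simplex_functional (fun v => e * f (pos v)) TX.
have lc w : weights T w -> l (bary pos w) = e * level w + c.
  move=> wT; rewrite lc' // /level mulr_sumr; congr (_ + _).
  by apply: eq_bigr => v _; rewrite mulrCA.
exists l, (e * t + c); split.
  by move=> _ /(cellP _ _ TX)[w [wT Jw ->]]; rewrite lc // lerD2r eJ.
apply/seteqP; split=> x.
  move=> /(cellP _ _ TX)[w [wT /= wt ->]]; split; last by rewrite /= lc // wt.
  by apply/(cellP _ _ TX); exists w; rewrite wt.
move=> [/(cellP _ _ TX)[w [wT Jw ->]] /=]; rewrite lc // => /addIr/(mulfI e0) wt.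
by apply/(cellP _ _ TX); exists w.
Qed.

(** The inner point in [C] makes [S] the smallest simplex containing [C], so inclusions of cells
    yield inclusions of simplices. *)
Definition cell_on S C d := [/\ S \in simplices X, C `<=` conv_hull pos S,
  exists2 w, inner_point S w & C (bary pos w) & has_dim C d].

Lemma codim1_faceP S T C D d e : cell_on S C d -> cell_on T D e ->
  codim1_face C D <-> is_face C D /\ e = d.+1.
Proof.
move=> [SX CS _ Cd] [TX DT _ De]; split.
  move=> [CD [k [Ck Dk]]]; split=> //.
  by rewrite (has_dim_uniq De Dk) (has_dim_uniq Cd Ck).
by move=> [CD E]; split=> //; exists d; rewrite -E.
Qed.

Lemma face_subset S T C D d e : cell_on S C d -> cell_on T D e ->
  is_face C D -> S \subset T.
Proof.
move=> [SX CS [w [wS w0] Cw] _] [TX DT _ _] [_ [l [b [_ E]]]].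
apply: (simplex_subset SX TX wS w0); apply: DT.
by move: Cw; rewrite E => -[].
Qed.

Lemma fat_cell S J : S \in simplices X -> fat J S ->
  cell_on S (cell S J) #|S|.-1.
Proof.
move=> SX SJ; split=> //; first exact: cell_sub.
  have [w [wS w0] [e e0 eJ]] := SJ; exists w => //; apply/(cellP _ _ SX).
  by exists w; split=> //; apply: eJ; rewrite subrr normr0.
apply: fat_dim => //; rewrite prednK // card_gt0; exact: simplex_neq0.
Qed.

End Cells.

(** * Incidences between cells *)

Section Incidences.
Context {R : realType} {N : nat} {V : finType}.
Context (X : simplicial_complex R N V) (f : 'rV[R]_N -> R).
Context (f_linear : linear_map X f).
Implicit Types (S T : {set V}) (w : V -> R) (J U : set R).

Local Notation pos := (pos X).
Local Notation level := (level X f).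
Local Notation cell := (cell X f).
Local Notation fat := (fat X f).

Lemma bracketE S : bracket X f S = [set level w | w in weights S].
Proof. by rewrite /bracket conv_hullE. Qed.

(** A point with value in [U] may lie on the boundary of the simplex; a small move towards the
    barycentre makes its weights positive and keeps the value well inside [U]. *)
Lemma fat_open U J S : S \in simplices X -> open U -> U `<=` J ->
  bracket X f S `&` U !=set0 -> fat J S.
Proof.
move=> SX Uo UJ [y0 []]; rewrite bracketE => -[w wS <-{y0}] Uw.
have /nbhs_ballP[e /= e0 eU] : nbhs (level w) U by apply: open_nbhs_nbhs.
have [uS u0] := uniform_weightP (R := R) (simplex_neq0 SX).
set u := uniform_weight S in uS u0; set m := level u; set y := level w in eU.
(* The denominator ensures both [a < 1] and a change of level of at most [e / 2]. *)
pose a := e / 2 / (1 + e / 2 + `|m - y|).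
have n0 : 0 <= `|m - y| by [].
have den : 0 < 1 + e / 2 + `|m - y| by lra.
have a0 : 0 < a by rewrite divr_gt0 //; lra.
have a1 : a < 1 by rewrite ltr_pdivrMr //; lra.
have ay : `|a * (m - y)| <= e / 2.
  rewrite normrM (gtr0_norm a0) mulrAC ler_pdivrMr // ler_pM2l; lra.
exists (fun v => (1 - a) * w v + a * u v).
  split; first by apply: weights_mix => //; lra.
  move=> v vS; have [p _ _] := wS; have := p v; have := u0 v vS => uv wv.
  have : 0 < a * u v by rewrite mulr_gt0.
  have : 0 <= (1 - a) * w v by rewrite mulr_ge0 //; lra.
  by lra.
exists (e / 2) => [|z]; first by lra.
rewrite levelD -/m -/y => zy; apply/UJ/eU; rewrite /ball /= distrC.
move: zy ay; rewrite !ltr_norml !ler_norml => /andP[? ?] /andP[? ?].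
by apply/andP; split; lra.
Qed.

Lemma fat_setT S : S \in simplices X -> fat setT S.
Proof.
move=> SX; have [uS u0] := uniform_weightP (R := R) (simplex_neq0 SX).
by exists (uniform_weight S) => //; exists 1.
Qed.

Lemma level_const S w c : weights S w -> (forall v, v \in S -> f (pos v) = c) ->
  level w = c.
Proof.
move=> [_ z s] h; rewrite -[RHS]mul1r -s mulr_suml; apply: eq_bigr => v _.
by have [/h->//|/z->] := boolP (v \in S); rewrite !mul0r.
Qed.

(** A point whose level lies slightly beyond [t], as seen from the level [m] of the barycentre, is
    mixed with the barycentre to give an inner point at level exactly [t]. *)
Lemma crossing_inner S (t : R) : S \in simplices X -> interior (bracket X f S) t ->
  (exists2 w, inner_point S w & level w = t) /\
  exists a b, [/\ a \in S, b \in S & f (pos a) != f (pos b)].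
Proof.
move=> SX /nbhs_ballP[e /= e0 eB].
have inB y : `|y - t| < e -> exists2 w, weights S w & level w = y.
  by move=> yt; have := eB y; rewrite /ball /= distrC bracketE => /(_ yt)[w]; exists w.
have [uS u0] := uniform_weightP (R := R) (simplex_neq0 SX).
set u := uniform_weight S in uS u0; set m := level u.
have n0 : 0 <= `|t - m| by [].
pose d := e / (1 + `|t - m|).
have d0 : 0 < d by rewrite divr_gt0 //; lra.
have [w wS wy] : exists2 w, weights S w & level w = t + d * (t - m).
  apply: inB; rewrite addrC addKr normrM (gtr0_norm d0) mulrAC.
  by rewrite ltr_pdivrMr ?ltr_pM2l //; lra.
have d10 : 0 < 1 + d by lra.
have a0 : 0 < d / (1 + d) by rewrite divr_gt0.
have a1 : d / (1 + d) < 1 by rewrite ltr_pdivrMr //; lra.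
split.
  (* The level of the mixture is (t + d (t - m) + d m) / (1 + d) = t. *)
  exists (fun v => (1 - d / (1 + d)) * w v + d / (1 + d) * u v).
    split; first by apply: weights_mix => //; lra.
    move=> v vS; have [p _ _] := wS; have := p v; have := u0 v vS => uv wv.
    have : 0 < d / (1 + d) * u v by rewrite mulr_gt0.
    have : 0 <= (1 - d / (1 + d)) * w v by rewrite mulr_ge0 //; lra.
    by lra.
  by rewrite levelD -/m wy; field; rewrite lt0r_neq0.
have /set0Pn[a aS] := simplex_neq0 SX.
have [[b bS ab]|H] := pselect (exists2 b, b \in S & f (pos a) != f (pos b)).
  by exists a, b.
have c v : v \in S -> f (pos v) = f (pos a).
  move=> vS; have [//|va] := eqVneq (f (pos v)) (f (pos a)).
  by case: H; exists v; rewrite // eq_sym.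
(* If [f] were constant on the vertices, only one level could occur, but [t] and [t + e / 2] both
   do. *)
have [w1 wS1 e1] := inB t ltac:(by rewrite subrr normr0).
have [w2 wS2 e2] : exists2 w, weights S w & level w = t + e / 2.
  by apply: inB; rewrite addrC addKr gtr0_norm; lra.
move: e1 e2; rewrite (level_const wS1 c) (level_const wS2 c); lra.
Qed.

(** The bound on the size of [S] keeps the truncated [#|S|.-2] equal to the dimension of the simplex
    minus 1. *)
Lemma slice_cell S (t : R) : S \in simplices X -> interior (bracket X f S) t ->
  (1 < #|S|)%N /\ cell_on X S (cell S [set t]) #|S|.-2.
Proof.
move=> SX /(crossing_inner SX)[[w wS wt] [a [b [aS bS ab]]]].
have S2 : (1 < #|S|)%N.
  by apply/card_gt1P; exists a, b; split=> //; apply: contraNneq ab => ->.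
split=> //; split=> //; first exact: cell_sub.
  by exists w => //; apply/(cellP f_linear _ _ SX); exists w; split=> //; case: wS.
apply: (slice_dim f_linear SX wS wt aS bS ab).
by case: #|S| S2 => [|[]].
Qed.

Lemma vertex_cell v : cell_on X [set v]%SET [set pos v] 0.
Proof.
have vX := simplices_vertex X v.
rewrite -(cell_vertex f_linear (J := setT)) //.
by have := fat_cell f_linear vX (fat_setT vX); rewrite cards1.
Qed.

Lemma vertex_sub v T J : T \in simplices X -> cell T J (pos v) -> v \in T.
Proof.
move=> TX /cell_sub vT; have vX := simplices_vertex X v.
rewrite -finset.sub1set.
apply: (@simplex_subset _ _ _ _ _ _ (vertex_weight v) vX TX).
- by apply: vertex_weightP; rewrite inE.
- by move=> u; rewrite inE /vertex_weight => ->.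
- by rewrite bary_vertex.
Qed.

Lemma vertex_face v T J : T \in simplices X -> J (f (pos v)) -> v \in T ->
  is_face [set pos v] (cell T J).
Proof.
move=> TX Jv vT; have vX := simplices_vertex X v.
rewrite -(cell_vertex f_linear (J := J)) //; apply: (cell_face f_linear vX TX).
  by rewrite finset.sub1set.
by rewrite (cell_vertex f_linear) //; exists (pos v).
Qed.

Lemma incidence_same S T J d e : cell_on X S (cell S J) d ->
  cell_on X T (cell T J) e ->
  codim1_face (cell S J) (cell T J) <-> (S \subset T) /\ e = d.+1.
Proof.
move=> cS cT; rewrite (codim1_faceP cS cT); split=> -[H ->]; split=> //.
  exact: face_subset cS cT H.
have [SX _ [w _ Sw] _] := cS; have [TX _ _ _] := cT.
by apply: (cell_face f_linear SX TX H); exists (bary pos w).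
Qed.

Lemma incidence_fat S T J : S \in simplices X -> T \in simplices X ->
  fat J S -> fat J T ->
  codim1_face (cell S J) (cell T J) <-> (S \subset T) /\ #|T| = #|S|.+1.
Proof.
move=> SX TX fS fT; rewrite (incidence_same (fat_cell f_linear SX fS) (fat_cell f_linear TX fT)).
have := simplex_neq0 SX; have := simplex_neq0 TX; rewrite -!card_gt0.
by case: #|S| => // m; case: #|T| => // k _ _ /=; split=> -[? E]; split=> //; [rewrite E|case: E].
Qed.

Lemma incidence_slice S T (t : R) : S \in simplices X -> T \in simplices X ->
  interior (bracket X f S) t -> interior (bracket X f T) t ->
  codim1_face (cell S [set t]) (cell T [set t]) <->
  (S \subset T) /\ #|T| = #|S|.+1.
Proof.
move=> SX TX /(slice_cell SX)[S2 cS] /(slice_cell TX)[T2 cT].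
rewrite (incidence_same cS cT).
case: #|S| S2 => [|[|m]] // _; case: #|T| T2 => [|[|k]] // _.
by rewrite /=; split=> -[? E]; split=> //; [rewrite E|case: E].
Qed.

Lemma incidence_vertex v T J d : cell_on X T (cell T J) d -> J (f (pos v)) ->
  codim1_face [set pos v] (cell T J) <-> v \in T /\ d = 1.
Proof.
move=> cT Jv; rewrite (codim1_faceP (vertex_cell v) cT); have [TX _ _ _] := cT.
split=> -[H ->]; split=> //; last exact: vertex_face.
by rewrite -finset.sub1set; apply: face_subset (vertex_cell v) cT H.
Qed.

Lemma no_face_of_vertex v S C d : cell_on X S C d -> ~ codim1_face C [set pos v].
Proof. by move=> cS; rewrite (codim1_faceP cS (vertex_cell v)) => -[]. Qed.

(** The dimensions are [#|S|.-2] and [#|T|.-1], so codimension 1 means equal sizes; with [S]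
    contained in [T] this gives equality. *)
Lemma incidence_attach S T J (t : R) : S \in simplices X -> T \in simplices X ->
  interior (bracket X f S) t -> fat J T -> endpoint J t ->
  codim1_face (cell S [set t]) (cell T J) <-> S = T.
Proof.
move=> SX TX cross fT Jt; have [S2 cS] := slice_cell SX cross.
have cT := fat_cell f_linear TX fT.
rewrite (codim1_faceP cS cT); split=> [[H E]|ST].
  apply/eqP; rewrite eqEcard (face_subset cS cT H) /=.
  by case: #|S| S2 E => [|[|m]] //= _; case: #|T| => //= k ->.
rewrite -ST; split; last by case: #|S| S2 => [|[|m]].
apply: (slice_face f_linear SX Jt).
by have [_ _ [w _ Sw] _] := cS; exists (bary pos w).
Qed.

(** An inner point at level [t] would put values on both sides of [t] into [J]. Hence a
    full-dimensional cell is never contained in the slice at an end of [J]. *)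
Lemma fat_off_level J S (t : R) : S \in simplices X -> fat J S -> endpoint J t ->
  exists2 x, cell S J x & f x != t.
Proof.
move=> SX [w [wS _] [e e0 eJ]] [_ Jt]; exists (bary pos w).
  apply/(cellP f_linear _ _ SX); exists w; split=> //; apply: eJ.
  by rewrite subrr normr0.
rewrite (f_bary f_linear SX wS); apply/eqP => wt.
have up : J (t + e / 2) by apply: eJ; rewrite wt addrC addKr gtr0_norm; lra.
have dn : J (t - e / 2).
  by apply: eJ; rewrite wt addrC addKr normrN gtr0_norm; lra.
by case: Jt => h; [have := h _ dn|have := h _ up]; lra.
Qed.

End Incidences.

(** * Block decomposition of incidence matrices *)

Section Matrices.
Context {R : realType} {N : nat}.

Definition cross_mx m n (c : 'I_m -> set 'rV[R]_N) (d : 'I_n -> set 'rV[R]_N) :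
  'M['F_2]_(m, n) := \matrix_(i, j) (`[< codim1_face (c i) (d j) >])%:R.

Lemma cat_cells_lshift m n (c : 'I_m -> set 'rV[R]_N) (d : 'I_n -> set 'rV[R]_N) i :
  cat_cells c d (lshift n i) = c i.
Proof. by rewrite /cat_cells (unsplitK (inl _ i)). Qed.

Lemma cat_cells_rshift m n (c : 'I_m -> set 'rV[R]_N) (d : 'I_n -> set 'rV[R]_N) i :
  cat_cells c d (rshift m i) = d i.
Proof. by rewrite /cat_cells (unsplitK (inr _ i)). Qed.

Lemma incidence_cat m n (c : 'I_m -> set 'rV[R]_N) (d : 'I_n -> set 'rV[R]_N) :
  incidence_mx (cat_cells c d) =
  block_mx (incidence_mx c) (cross_mx c d) (cross_mx d c) (incidence_mx d).
Proof.
apply/matrixP => i j; rewrite mxE.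
case: (split_ordP i) => i' ->; case: (split_ordP j) => j' ->;
by rewrite ?cat_cells_lshift ?cat_cells_rshift
  ?block_mxEul ?block_mxEur ?block_mxEdl ?block_mxEdr mxE.
Qed.

Lemma cross_mx0 m n (c : 'I_m -> set 'rV[R]_N) (d : 'I_n -> set 'rV[R]_N) :
  (forall i j, ~ codim1_face (c i) (d j)) -> cross_mx c d = 0.
Proof. by move=> h; apply/matrixP => i j; rewrite !mxE asboolF. Qed.

Lemma cross_mx_catl m1 m2 n (c1 : 'I_m1 -> set 'rV[R]_N) (c2 : 'I_m2 -> set 'rV[R]_N)
    (d : 'I_n -> set 'rV[R]_N) :
  cross_mx (cat_cells c1 c2) d = col_mx (cross_mx c1 d) (cross_mx c2 d).
Proof.
apply/matrixP => i j; rewrite mxE; case: (split_ordP i) => i' ->;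
by rewrite ?cat_cells_lshift ?cat_cells_rshift ?col_mxEu ?col_mxEd mxE.
Qed.

Lemma cross_mx_catr m n1 n2 (c : 'I_m -> set 'rV[R]_N) (d1 : 'I_n1 -> set 'rV[R]_N)
    (d2 : 'I_n2 -> set 'rV[R]_N) :
  cross_mx c (cat_cells d1 d2) = row_mx (cross_mx c d1) (cross_mx c d2).
Proof.
apply/matrixP => i j; rewrite mxE; case: (split_ordP j) => j' ->;
by rewrite ?cat_cells_lshift ?cat_cells_rshift ?row_mxEl ?row_mxEr mxE.
Qed.

End Matrices.

(** * The blocks for slices and slabs of X *)

Section Blocks.
Context {R : realType} {N : nat} {V : finType}.
Context (X : simplicial_complex R N V) (f : 'rV[R]_N -> R).
Context (f_linear : linear_map X f) (f_generic : generic X f).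
Context {n : nat} (s : 'I_n -> {set V}) (s_order : face_ordering X s).
Implicit Types (J : set R) (t : R) (A : {set 'I_n}).

Local Notation pos := (pos X).
Local Notation cell := (cell X f).
Local Notation fat := (fat X f).
Local Notation slab J := (realization X `&` f @^-1` J).
Local Notation M := (incidence_mx (simplex_cells X s)).

Lemma ordered_simplex i : s i \in simplices X.
Proof. by case: s_order => _ h _; apply/h; exists i. Qed.

(** With [J] the whole line, the incidences of X itself fall under the criterion for cells. *)
Lemma simplex_cellE i : simplex_cells X s i = cell (s i) setT.
Proof.
apply/seteqP; split=> x; last exact: cell_sub.
by move=> h; split=> //; split=> //; exists (s i) => //; apply: ordered_simplex.
Qed.

Lemma simplex_incidenceP i j : codim1_face (simplex_cells X s i) (simplex_cells X s j)
  <-> (s i \subset s j) /\ #|s j| = #|s i|.+1.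
Proof.
have iX := ordered_simplex i; have jX := ordered_simplex j.
by rewrite !simplex_cellE (incidence_fat f_linear) //; apply: fat_setT.
Qed.

Lemma crossing_bracket i t : i \in crossing X f s t -> interior (bracket X f (s i)) t.
Proof. by rewrite inE => /asboolP. Qed.

Lemma slice_minor A (Y : set 'rV[R]_N) :
  (forall i j, i \in A -> j \in A ->
    codim1_face (conv_hull pos (s i) `&` Y) (conv_hull pos (s j) `&` Y) <->
    (s i \subset s j) /\ #|s j| = #|s i|.+1) ->
  incidence_mx (slice_cells X s (A := A) Y) = minor_mx M A.
Proof.
move=> h; apply/matrixP => i j; rewrite !mxE; congr (_%:R); congr nat_of_bool.
apply: asbool_equiv_eq; rewrite simplex_incidenceP; apply: h; exact: enum_valP.
Qed.

Lemma fat_minor A J : (forall i, i \in A -> fat J (s i)) ->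
  incidence_mx (slice_cells X s (A := A) (slab J)) = minor_mx M A.
Proof.
move=> h; apply: slice_minor => i j iA jA.
by apply: (incidence_fat f_linear (ordered_simplex i) (ordered_simplex j)); apply: h.
Qed.

Lemma crossing_minor t :
  incidence_mx (slice_cells X s (A := crossing X f s t) (X_at X f t)) =
  minor_mx M (crossing X f s t).
Proof.
apply: slice_minor => i j /crossing_bracket iA /crossing_bracket jA.
exact: (incidence_slice f_linear (ordered_simplex i) (ordered_simplex j)).
Qed.

Lemma cells_atP t k :
  (exists2 v, f (pos v) = t & cells_at X f s t k = [set pos v]) \/
  (exists2 i, i \in crossing X f s t & cells_at X f s t k = cell (s i) [set t]).
Proof.
rewrite /cells_at; case: (split_ordP k) => k' ->.
  rewrite cat_cells_lshift; left; exists (enum_val k') => //.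
  by have := enum_valP k'; rewrite inE => /eqP.
by rewrite cat_cells_rshift; right; exists (enum_val k') => //; apply: enum_valP.
Qed.

Lemma cells_at_level t k x : cells_at X f s t k x -> f x = t.
Proof. by case: (cells_atP k) => [[v vt ->] ->|[i _ ->] [_ [_ ->]]]. Qed.

Lemma cells_at_neq0 t k : cells_at X f s t k !=set0.
Proof.
case: (cells_atP k) => [[v vt ->]|[i /crossing_bracket it ->]].
  by exists (pos v).
have [_ [_ _ [w _ iw] _]] := slice_cell f_linear (ordered_simplex i) it.
by exists (bary pos w).
Qed.

(** A face is nonempty and contained in its cell, whereas cells at different levels are disjoint. *)
Lemma cross_levels t1 t2 : t1 != t2 ->
  cross_mx (cells_at X f s t1) (cells_at X f s t2) = 0.
Proof.
move=> t12; apply: cross_mx0 => i j [[_ [l [b [_ E]]]] _].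
have [x ix] := cells_at_neq0 i; have xt1 := cells_at_level ix.
move: ix; rewrite E => -[/cells_at_level xt2 _].
by rewrite -xt1 -xt2 eqxx in t12.
Qed.

Lemma fat_cross0 A J t : endpoint J t -> (forall i, i \in A -> fat J (s i)) ->
  cross_mx (slice_cells X s (A := A) (slab J)) (cells_at X f s t) = 0.
Proof.
move=> Jt h; apply: cross_mx0 => i j [[_ [l [b [_ E]]]] _].
have [x ix] := fat_off_level f_linear (ordered_simplex _) (h _ (enum_valP i)) Jt.
move: ix; rewrite -[cell _ _]/(slice_cells X s (slab J) i) E.
by case=> /cells_at_level-> _; rewrite eqxx.
Qed.

Lemma fat_attaching A J t : endpoint J t -> (forall i, i \in A -> fat J (s i)) ->
  cross_mx (cells_at X f s t) (slice_cells X s (A := A) (slab J)) =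
  attaching_mx X f s t A.
Proof.
move=> Jt h; apply/matrixP => k j; rewrite !mxE; congr (_%:R); congr nat_of_bool.
apply: asbool_equiv_eq; have := h _ (enum_valP j).
rewrite /slice_cells; set i := enum_val j => fi; have iX := ordered_simplex i.
have ci := fat_cell f_linear iX fi.
have i0 : (0 < #|s i|)%N by rewrite card_gt0 (simplex_neq0 iX).
rewrite -[conv_hull _ _ `&` _]/(cell (s i) J) /attaching_rule.
rewrite -[conv_hull _ _ `&` _]/(cell (s i) [set t]).
case: (cells_atP k) => [[v vt ->]|[i' it ->]].
  have Jv : J (f (pos v)) by rewrite vt; case: Jt.
  rewrite (incidence_vertex f_linear ci Jv); split.
    move=> [vi E]; right; exists v; split=> //.
    by case: #|s i| i0 E => //= m _ ->.
  (* If the slice of [s i] is the single point [pos v], its dimension [#|s i|.-2] is 0, so [s i] is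
     an edge. *)
  move=> [[/crossing_bracket ii E]|[v' [E v'i i2]]].
    have [i2 cs] := slice_cell f_linear iX ii.
    rewrite -E in cs; have [_ _ _ d1] := cs; have [_ _ _ d2] := vertex_cell f_linear v.
    split; first by apply: (@vertex_sub _ _ _ X f v (s i) [set t] iX); rewrite -E.
    by have := has_dim_uniq d1 d2; case: #|s i| i2 => [|[|[]]].
  split; last by rewrite i2.
  suff -> : v = v' by [].
  by apply: f_generic; rewrite /=; congr f; have : [set pos v'] (pos v) by rewrite -E.
have i'X := ordered_simplex i'; have i't := crossing_bracket it.
rewrite (incidence_attach f_linear i'X iX i't fi Jt); split.
  move=> E; left; have [s_inj _ _] := s_order.
  by rewrite -(s_inj _ _ E).
move=> [[/crossing_bracket ii E]|[v [E vi i2]]].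
  (* Equal slices come from equal simplices: each contains an inner point of its own simplex, which
     gives both inclusions. *)
  have [_ [_ Es [w [wS w0] Ew] _]] := slice_cell f_linear i'X i't.
  have [_ [_ Es' [w' [wS' w0'] Ew'] _]] := slice_cell f_linear iX ii.
  apply/eqP; rewrite finset.eqEsubset; apply/andP; split.
    by apply: (simplex_subset i'X iX wS w0); rewrite E in Ew; apply: Es'.
  by apply: (simplex_subset iX i'X wS' w0'); rewrite -E in Ew'; apply: Es.
(* A slice reduced to a vertex [v] would place [s i'] inside the singleton of [v], but a crossing
   simplex has at least two vertices. *)
have [S2 cs] := slice_cell f_linear i'X i't.
rewrite E in cs; have [_ _ [w [wS w0] Ew] _] := cs.
have := simplex_subset i'X (simplices_vertex X v) wS w0.
have [_ vv _ _] := vertex_cell f_linear v.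
by move=> /(_ (vv _ Ew))/subset_leq_card; rewrite cards1 leqNgt S2.
Qed.

(** The zero blocks on the left hold because a vertex has dimension 0 and hence no face of
    codimension 1. *)
Lemma incidence_cells_at t :
  incidence_mx (cells_at X f s t) =
  block_mx 0
    (cross_mx (fun i : 'I_#|level_vertices X f t| => [set pos (enum_val i)])
              (slice_cells X s (A := crossing X f s t) (X_at X f t)))
    0 (minor_mx M (crossing X f s t)).
Proof.
rewrite /cells_at incidence_cat crossing_minor; congr block_mx.
  apply: cross_mx0 => i j.
  exact: (no_face_of_vertex f_linear (vertex_cell f_linear _)).
apply: cross_mx0 => i j.
have /crossing_bracket it := enum_valP i.
have [_ ci] := slice_cell f_linear (ordered_simplex _) it.
exact: (no_face_of_vertex f_linear ci).
Qed.

Lemma incidence_fat_cells A J t : endpoint J t -> (forall i, i \in A -> fat J (s i)) ->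
  incidence_mx (cat_cells (cells_at X f s t) (slice_cells X s (A := A) (slab J))) =
  block_mx (incidence_mx (cells_at X f s t)) (attaching_mx X f s t A)
           0 (minor_mx M A).
Proof.
move=> Jt h; by rewrite incidence_cat fat_attaching // fat_cross0 // fat_minor.
Qed.

End Blocks.

(** * Assembly of the incidence matrices *)

Theorem mainTheorem2 (R : realType) (N : nat) (V : finType)
    (X : simplicial_complex R N V) (f : 'rV[R]_N -> R)
    (f_linear : linear_map X f) (f_generic : generic X f)
    (n : nat) (s : 'I_n -> {set V}) (s_order : face_ordering X s)
    (t t1 t2 : R) (t1_lt_t2 : t1 < t2) :
  let M := incidence_mx (simplex_cells X s) in
  let M_at u := incidence_mx (cells_at X f s u) in
  [/\
    (* (1) *)
    ((forall v, f (pos X v) != t) ->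
       exists e : #|crossing X f s t| =
                  (#|level_vertices X f t| + #|crossing X f s t|)%N,
         M_at t = castmx (e, e) (minor_mx M (crossing X f s t))) /\
    (forall v, f (pos X v) = t ->
       exists e : (1 + #|crossing X f s t|)%N =
                  (#|level_vertices X f t| + #|crossing X f s t|)%N,
         M_at t = castmx (e, e)
           (block_mx (0 : 'M['F_2]_1) (vertex_row X f s t v)
                     0          (minor_mx M (crossing X f s t)))),
    (* (2) *)
    incidence_mx (cells_ge X f s t) =
      block_mx (M_at t) (attaching_mx X f s t (above X f s t))
               0        (minor_mx M (above X f s t)),
    incidence_mx (cells_le X f s t) =
      block_mx (M_at t) (attaching_mx X f s t (below X f s t))
               0        (minor_mx M (below X f s t)) &
    (* (3) *)
    incidence_mx (cells_btw X f s t1 t2) =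
      block_mx (block_mx (M_at t1) 0 0 (M_at t2))
               (col_mx (attaching_mx X f s t1 (between X f s t1 t2))
                       (attaching_mx X f s t2 (between X f s t1 t2)))
               0
               (minor_mx M (between X f s t1 t2))].
Proof.
move=> M M_at; have sX := ordered_simplex s_order.
(* [above], [below] and [between] all ask that the bracket meet an open interval contained in the
   closed interval of the slab. *)
have fatU U J : open U -> U `<=` J -> forall i,
    `[< bracket X f (s i) `&` U !=set0 >] -> fat X f J (s i).
  by move=> Uo UJ i /asboolP; apply: fat_open.
split.
- split=> [no_v|v vt].
    have lv0 : #|level_vertices X f t| = 0.
      by apply: eq_card0 => v; rewrite inE (negbTE (no_v v)).
    have e : #|crossing X f s t| = (#|level_vertices X f t| + #|crossing X f s t|)%N.
      by rewrite lv0.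
    exists e; rewrite /M_at incidence_cells_at //; apply/matrixP => i j.
    rewrite castmxE; case: (split_ordP i) => i' -> ; first by have := ltn_ord i'; rewrite {2}lv0.
    case: (split_ordP j) => j' -> ; first by have := ltn_ord j'; rewrite {2}lv0.
    rewrite block_mxEdr; congr (minor_mx _ _ _ _); apply: val_inj => /=;
      by rewrite lv0.
  (* Genericity leaves [v] as the only vertex at level [t], so the vertex block has size 1. *)
  have vE w : (w \in level_vertices X f t) = (w == v).
    rewrite inE; apply/eqP/eqP => [wt|-> //].
    by apply: f_generic; rewrite /= wt vt.
  have lv1 : #|level_vertices X f t| = 1%N.
    by rewrite -(card1 v); apply: eq_card.
  have e : (1 + #|crossing X f s t|)%N =
           (#|level_vertices X f t| + #|crossing X f s t|)%N by rewrite lv1.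
  exists e; rewrite /M_at incidence_cells_at //; apply/matrixP => i j.
  have castl (k : 'I_#|level_vertices X f t|) :
      cast_ord (esym e) (lshift _ k) = lshift _ ord0.
    by apply: val_inj => /=; have := ltn_ord k; rewrite {2}lv1; case: (val k).
  have castr k : cast_ord (esym e) (rshift _ k) = rshift _ k.
    by apply: val_inj => /=; rewrite lv1.
  rewrite castmxE; case: (split_ordP i) => i' ->; case: (split_ordP j) => j' ->;
    rewrite ?castl ?castr ?block_mxEul ?block_mxEur ?block_mxEdl ?block_mxEdr //;
    rewrite !mxE //.
  congr (_%:R); congr nat_of_bool.
  have -> : enum_val i' = v by apply/eqP; rewrite -vE; apply: enum_valP.
  have /crossing_bracket jt := enum_valP j'.
  have [j2 cj] := slice_cell f_linear (sX _) jt.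
  (* The slice has dimension [#|s (enum_val j')|.-2], which is 1 exactly for three vertices. *)
  apply/asboolP/andP; rewrite (incidence_vertex f_linear cj) //.
    by move=> [-> E]; split=> //; case: #|_| j2 E => [|[|m]] //= _ ->.
  by move=> [-> /eqP->].
- apply: (incidence_fat_cells f_linear f_generic s_order) => [|i].
    split; first by rewrite /= in_itv /= lexx.
    by left=> y /=; rewrite in_itv /= andbT.
  rewrite inE; apply: fatU => [|y /=]; first exact: interval_open.
  by rewrite !in_itv /= !andbT => /ltW.
- apply: (incidence_fat_cells f_linear f_generic s_order) => [|i].
    split; first by rewrite /= in_itv /= lexx.
    by right=> y /=; rewrite in_itv.
  rewrite inE; apply: fatU => [|y /=]; first exact: interval_open.
  by rewrite !in_itv /= => /ltW.
have e1 : endpoint `[t1, t2] t1.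
  split; first by rewrite /= in_itv /= lexx ltW.
  by left=> y /=; rewrite in_itv /= => /andP[].
have e2 : endpoint `[t1, t2] t2.
  split; first by rewrite /= in_itv /= lexx ltW.
  by right=> y /=; rewrite in_itv /= => /andP[].
have fat_btw i : i \in between X f s t1 t2 -> fat X f `[t1, t2] (s i).
  rewrite inE; apply: fatU => [|y /=]; first exact: interval_open.
  by rewrite !in_itv /= => /andP[/ltW-> /ltW->].
have t12 : t1 != t2 by rewrite lt_eqF.
(* The two end slices are attached separately to the slab, and the blocks between them vanish since
   their levels differ. *)
rewrite /cells_btw incidence_cat cross_mx_catl cross_mx_catr.
rewrite incidence_cat !cross_levels // 1?eq_sym //.
by rewrite !fat_attaching // !fat_cross0 // fat_minor // row_mx0.
Qed.
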